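(* Let $G$ be a $k$-regular Ramanujan graph with $n$ vertices, let $\epsilon>0$, fix a vertex $x$ of $G$, and let $R$ be an integer with $R>(1+\epsilon)\log_{k-1}(n)$. Let $M(x,R)$ be the set of all vertices $y$ of $G$ such that there is no non-backtracking walk of length exactly $R$ from $x$ to $y$. Then $$|M(x,R)|\le n^{1-\epsilon}(1+R)^2 .$$
   Context: Here a $k$-regular Ramanujan graph is a finite connected $k$-regular graph $G$ whose adjacency matrix has the property that every eigenvalue $\lambda$ other than the trivial eigenvalue $k$ (which has multiplicity one) satisfies $|\lambda|\le 2\sqrt{k-1}$. A non-backtracking walk of length $R$ from $x$ to $y$ is a sequence of vertices $x=v_0,v_1,\dots,v_R=y$ with $v_{j}$ adjacent to $v_{j+1}$ for each $j$ and $v_{j+2}\neq v_j$ for each $j$; edges may be traversed several times, but never immediately back along the edge just used. *)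

(* Defs.v *)
From HB Require Import structures.
From mathcomp Require Import all_boot all_order all_algebra.
From mathcomp Require Import all_classical all_reals all_analysis.

Set Implicit Arguments.
Unset Strict Implicit.
Unset Printing Implicit Defensive.

Import Order.TTheory GRing.Theory Num.Theory.

Local Open Scope ring_scope.

(* A finite simple graph is a symmetric irreflexive relation on a finType. *)
Definition simple_graph (V : finType) (e : rel V) : Prop :=
  symmetric e /\ irreflexive e.

Definition graph_connected (V : finType) (e : rel V) : Prop :=
  forall x y : V, connect e x y.

Definition regular_graph (V : finType) (e : rel V) (k : nat) : Prop :=
  forall x : V, #|[set y | e x y]| = k.

Definition adjmx (F : realType) (V : finType) (e : rel V) : 'M[F]_#|V| :=
  \matrix_(i < #|V|, j < #|V|) (e (enum_val i) (enum_val j))%:R.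

(* The adjacency matrix is real symmetric, so all its eigenvalues lie in F.
   The simplicity of the eigenvalue k is a consequence of connectedness and
   regularity, see [rank_trivial_eigenspace]. *)
Definition ramanujan_graph (F : realType) (V : finType) (e : rel V) (k : nat) :
    Prop :=
  [/\ simple_graph e, graph_connected e, regular_graph e k &
      forall lambda : F, eigenvalue (adjmx F e) lambda -> lambda != k%:R ->
        `|lambda| <= 2 * Num.sqrt (k%:R - 1)].

Definition nonbacktracking_walk (V : finType) (e : rel V) (R : nat) (x y : V)
    (v : {ffun 'I_R.+1 -> V}) : bool :=
  [&& v ord0 == x,
      v ord_max == y,
      [forall i : 'I_R.+1, forall j : 'I_R.+1,
         (j == i.+1 :> nat) ==> e (v i) (v j)] &
      [forall i : 'I_R.+1, forall j : 'I_R.+1,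
         (j == i.+2 :> nat) ==> (v j != v i)]].

(* The set M(x, R). *)
Definition missed_vertices (V : finType) (e : rel V) (x : V) (R : nat) :
    {set V} :=
  [set y | ~~ [exists v : {ffun 'I_R.+1 -> V}, nonbacktracking_walk e x y v]].

Definition logb (F : realType) (b a : F) : F := ln a / ln b.

Lemma sum_adjmx (F : realType) (V : finType) (e : rel V) (k : nat)
    (j : 'I_#|V|) :
  symmetric e -> regular_graph e k -> \sum_i adjmx F e i j = k%:R.
Proof.
move=> se reg; rewrite -(reg (enum_val j)) -sum1_card natr_sum [RHS]big_mkcond /=.
rewrite [RHS](reindex_onto (@enum_val V predT) enum_rank) /=; last first.
  by move=> i _; rewrite enum_rankK.
apply: eq_big => [i|i _]; first by rewrite enum_valK eqxx.
by rewrite mxE se inE; case: (e _ _).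
Qed.

Lemma rank_trivial_eigenspace (F : realType) (V : finType) (e : rel V)
    (k : nat) :
  simple_graph e -> graph_connected e -> regular_graph e k -> V ->
  \rank (eigenspace (adjmx F e) k%:R) = 1%N.
Proof.
move=> [se _] conn reg x0.
set A := adjmx F e; pose u : 'rV[F]_#|V| := const_mx 1.
have u0 : u != 0.
  apply/eqP => /matrixP /(_ ord0 (enum_rank x0)); rewrite !mxE => /eqP.
  by rewrite oner_eq0.
have uE : (u <= eigenspace A k%:R)%MS.
  apply/eigenspaceP; apply/matrixP => i j; rewrite !mxE mulr1.
  rewrite -(sum_adjmx F j se reg).
  by apply: eq_bigr => l _; rewrite !mxE mul1r.
apply/eqP; rewrite eqn_leq; apply/andP; split; last first.
  by apply: leq_trans (mxrankS uE); rewrite lt0n mxrank_eq0.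
suff /mxrankS h : (eigenspace A k%:R <= u)%MS.
  by apply: leq_trans h _; exact: rank_leq_row.
apply/rV_subP => v /eigenspaceP vA.
pose f (y : V) := v ord0 (enum_rank y).
have [m _ mP] := @Order.TotalTheory.arg_maxP _ _ _ x0 predT f isT.
have step y : f y = f m -> forall z, e y z -> f z = f m.
  move=> fy z yz.
  have s0 : \sum_l (f y - v ord0 l) * A l (enum_rank y) = 0.
    have /matrixP /(_ ord0 (enum_rank y)) := vA.
    rewrite !mxE => H.
    rewrite -[RHS](subrr (k%:R * f y)).
    rewrite -[in X in _ = _ - X]H -(sum_adjmx F (enum_rank y) se reg).
    rewrite mulr_suml -sumrB; apply: eq_bigr => l _.
    by rewrite mulrBl [f y * _]mulrC.
  have s1 l : true -> 0 <= (f y - v ord0 l) * A l (enum_rank y).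
    move=> _; apply: mulr_ge0; last by rewrite mxE ler0n.
    rewrite subr_ge0 fy -[l]enum_valK; exact: mP.
  have /eqP := s0; rewrite psumr_eq0 // => /allP /(_ (enum_rank z)).
  rewrite mem_index_enum => /(_ isT) /=.
  by rewrite mxE !enum_rankK se yz mulr1 subr_eq0 fy => /eqP.
have cst y : f y = f m.
  have /connectP [p pp ->] := conn m y.
  suff H q w : f w = f m -> path e w q -> f (last w q) = f m by exact: H pp.
  elim: q w => [|z q IH] w fw //= /andP[wz zq].
  by apply: IH zq; apply: step wz.
apply/sub_rVP; exists (f m); apply/matrixP => i j.
by rewrite !mxE mulr1 ord1 -[j]enum_valK; exact: cst.
Qed.

(* Main.v *)
(* Let b_R(y) count the non-backtracking walks of length R from x to y, and put
   q = k - 1.  Then b_1 = b_0 A, b_2 = b_1 A - k b_0 and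
   b_{R+1} = b_R A - q b_{R-1} for R >= 2, so b_R = b_0 p_R(A).  Subtracting the
   mean k q^{R-1} / n removes the component along the trivial eigenvector.
   On the rest of the spectrum l = 2 sqrt(q) t with |t| <= 1, and
     p_R(l) = q^{R/2} ((1 - 1/q) U_R(t) + (2/q) T_R(t))
   with T_R, U_R the Chebyshev polynomials, so that |p_R(l)| <= q^{R/2} (R + 1).
   Each y in M(x, R) has b_R(y) = 0 and contributes (k q^{R-1} / n)^2 to the
   squared norm of the deviation, which is at most q^R (R + 1)^2; hence
   |M(x, R)| q^R <= n^2 (R + 1)^2. *)

Require Import Defs.
From HB Require Import structures.
From mathcomp Require Import all_boot all_order all_algebra.
From mathcomp Require Import all_classical all_reals all_analysis.
From mathcomp Require Import complex ring lra.

Import Order.TTheory GRing.Theory Num.Theory.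

Local Open Scope ring_scope.

(** * Comparing norms through an eigenbasis of a real symmetric matrix *)

Section Spectral.

Local Open Scope sesquilinear_scope.

Lemma mulmx_Parseval (C : numClosedFieldType) (n : nat) (P : 'M[C]_n)
    (v : 'rV[C]_n) :
  P \is unitarymx -> \sum_i `|(v *m P) 0 i| ^+ 2 = \sum_i `|v 0 i| ^+ 2.
Proof.
move=> uP.
have sumE (w : 'rV[C]_n) : \sum_i `|w 0 i| ^+ 2 = (w *m w ^t*) 0 0.
  by rewrite mxE; apply: eq_bigr => i _; rewrite normCK !mxE.
rewrite !sumE trmx_mul map_mxM mulmxA -[v *m P *m _]mulmxA.
by have /unitarymxP -> := uP; rewrite mulmx1.
Qed.

(* Diagonalise unitarily over [F[i]]; since the eigenvalues are real, the real
   and imaginary parts of the eigenvectors are again eigenvectors. *)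
Lemma symmetric_norm_bound (F : rcfType) (n : nat) (A : 'M[F]_n)
    (g h : 'rV[F]_n) (B : F) :
  A^T = A ->
  (forall (l : F) (v : 'cV[F]_n), A *m v = l *: v ->
     `|(h *m v) 0 0| <= B * `|(g *m v) 0 0|) ->
  \sum_i h 0 i ^+ 2 <= B ^+ 2 * \sum_i g 0 i ^+ 2.
Proof.
move=> symA hg.
pose f := real_complex F.
pose AC := map_mx f A.
have hermA : AC \is hermsymmx.
  apply: realsym_hermsym.
    by apply/is_hermitianmxP; rewrite expr0 scale1r map_mx_id // map_trmx symA.
  by apply/mxOverP => i j; rewrite mxE; apply/complex_realP; eexists.
have uP : (spectralmx AC) ^t* \is unitarymx.
  by rewrite trmxC_unitary spectral_unitarymx.
have Adiag : AC *m (spectralmx AC) ^t* =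
    (spectralmx AC) ^t* *m diag_mx (spectral_diag AC).
  have /orthomx_spectralP {1}-> := hermitian_normalmx hermA.
  have uS := spectral_unitarymx AC.
  by rewrite invmx_unitary // -!mulmxA (unitarymxP uS) mulmx1.
have dreal := hermitian_spectral_diag_real hermA.
move: (spectralmx AC ^t*) (spectral_diag AC) uP Adiag dreal.
move=> P d uP Adiag dreal.
pose vr i : 'cV[F]_n := \col_j complex.Re (P j i).
pose vi i : 'cV[F]_n := \col_j complex.Im (P j i).
(* For a real [w], the real and imaginary parts of its complex coordinate are the pairings with
   [vr i] and [vi i], to which the hypothesis on real vectors applies. *)
have coordE (w : 'rV[F]_n) i : (map_mx f w *m P) 0 i =
    Complex ((w *m vr i) 0 0) ((w *m vi i) 0 0).
  rewrite !mxE; apply/eqP; rewrite eq_complex; apply/andP; split; apply/eqP.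
    rewrite (raddf_sum (@complex.Re F : Rcomplex F -> F)) /=.
    apply: eq_bigr => j _; rewrite !mxE.
    by case: (P j i) => a b /=; rewrite mul0r subr0.
  rewrite (raddf_sum (@complex.Im F : Rcomplex F -> F)) /=.
  apply: eq_bigr => j _; rewrite !mxE.
  by case: (P j i) => a b /=; rewrite mul0r addr0.
have normE (w : 'rV[F]_n) i : `|(map_mx f w *m P) 0 i| ^+ 2 =
    f ((w *m vr i) 0 0 ^+ 2 + (w *m vi i) 0 0 ^+ 2).
  by rewrite coordE -add_Re2_Im2.
have ParsevalF (w : 'rV[F]_n) : \sum_i w 0 i ^+ 2 =
    \sum_i ((w *m vr i) 0 0 ^+ 2 + (w *m vi i) 0 0 ^+ 2).
  apply: (@complexI F); rewrite !(rmorph_sum (real_complex F)) -/f /=.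
  rewrite -[RHS](eq_bigr _ (fun i _ => normE w i)).
  rewrite mulmx_Parseval //; apply: eq_bigr => i _.
  by rewrite mxE -add_Re2_Im2 /= expr0n addr0.
(* [A] and the eigenvalue [l] are both real, so the complex eigenvector equation splits into its two
   parts. *)
have eigv i : exists l, A *m vr i = l *: vr i /\ A *m vi i = l *: vi i.
  have /mxOverP /(_ 0 i) /complex_realP [l dl] := dreal.
  exists l.
  have eigC j : (AC *m P) j i = P j i * f l.
    rewrite Adiag mxE (bigD1 i) //= big1 ?addr0 => [|j' jj].
      by rewrite !mxE eqxx mulr1n dl.
    by rewrite !mxE (negPf jj) mulr0.
  have rowE j : (AC *m P) j i = Complex ((A *m vr i) j 0) ((A *m vi i) j 0).
    have := coordE (row j A) i; rewrite map_row -!row_mul !mxE /= => <-.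
    by apply: eq_bigr => a _; rewrite !mxE.
  split; apply/matrixP => j z; rewrite ord1.
    have := eigC j; rewrite rowE => /(congr1 (@complex.Re F)) /= ->.
    by rewrite !mxE; case: (P j i) => a b /=; rewrite mulr0 subr0 mulrC.
  have := eigC j; rewrite rowE => /(congr1 (@complex.Im F)) /= ->.
  by rewrite !mxE; case: (P j i) => a b /=; rewrite mulr0 add0r mulrC.
rewrite !ParsevalF mulr_sumr; apply: ler_sum => i _.
have [l [/hg er /hg ei]] := eigv i.
have sqb (a b : F) : `|a| <= B * `|b| -> a ^+ 2 <= B ^+ 2 * b ^+ 2.
  move=> ab; rewrite -(real_normK (num_real a)) -(real_normK (num_real b)).
  by rewrite -exprMn ler_sqr ?nnegrE ?normr_ge0 // (le_trans _ ab).
by rewrite mulrDr lerD // sqb.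
Qed.

End Spectral.

(** * Chebyshev polynomials and the scalar recurrence *)

(* [chebyshev t n] is the pair (T_n(t), U_{n-1}(t)). *)
Fixpoint chebyshev {F : pzRingType} (t : F) (n : nat) : F * F :=
  if n is m.+1 then
    let: (c, v) := chebyshev t m in (t * c - (1 - t ^+ 2) * v, t * v + c)
  else (1, 0).

Lemma chebyshev_rec {F : comPzRingType} (t : F) (n : nat) :
  chebyshev t n.+2 =
  (2 * t * (chebyshev t n.+1).1 - (chebyshev t n).1,
   2 * t * (chebyshev t n.+1).2 - (chebyshev t n).2).
Proof. by rewrite /=; case: (chebyshev t n) => c v /=; congr pair; ring. Qed.

(** At [t = cos a] this is [cos^2 (n a) + sin^2 (n a) = 1]; one step of the recursion is a rotation
    and preserves the form. *)
Lemma chebyshev_Pell {F : comPzRingType} (t : F) (n : nat) :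
  (chebyshev t n).1 ^+ 2 + (1 - t ^+ 2) * (chebyshev t n).2 ^+ 2 = 1.
Proof.
elim: n => [|n] /=; first by ring.
by case: (chebyshev t n) => c v /= cv; rewrite -[RHS]cv; ring.
Qed.

Lemma chebyshev1_le1 {F : realDomainType} (t : F) (n : nat) :
  `|t| <= 1 -> `|(chebyshev t n).1| <= 1.
Proof.
move=> t1.
have t2 : t ^+ 2 <= 1 by rewrite -(real_normK (num_real t)) exprn_ile1.
rewrite -(@ler_sqr _ `|_|) ?nnegrE // real_normK ?num_real // expr1n.
rewrite -[leRHS](chebyshev_Pell t n) lerDl.
by rewrite mulr_ge0 ?sqr_ge0 // subr_ge0.
Qed.

(** Since U_n = t U_{n-1} + T_n, each step adds at most 1 to the absolute value. *)
Lemma chebyshev2_le {F : realDomainType} (t : F) (n : nat) :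
  `|t| <= 1 -> `|(chebyshev t n).2| <= n%:R.
Proof.
move=> t1; elim: n => [|n IHn] /=; first by rewrite normr0.
have := chebyshev1_le1 t n t1.
case: (chebyshev t n) IHn => c v /= vn c1.
rewrite -natr1 (le_trans (ler_normD _ _)) // lerD // normrM.
by rewrite (le_trans _ vn) // ler_piMl.
Qed.

(* Bounding U_n - U_{n-2} / q termwise is not enough; the rewriting as
   (1 - 1/q) U_n + (2/q) T_n is what keeps the bound at n + 1. *)
Lemma nonbacktracking_recurrence_bound (F : rcfType) (q l : F) (p : nat -> F) :
  1 <= q -> `|l| <= 2 * Num.sqrt q ->
  p 1%N = l * p 0%N -> p 2 = l * p 1%N - (q + 1) * p 0%N ->
  (forall n, p n.+3 = l * p n.+2 - q * p n.+1) ->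
  forall n, `|p n.+1| <= Num.sqrt q ^+ n.+1 * n.+2%:R * `|p 0%N|.
Proof.
move=> q1 lq p1 p2 p3 n.
have q0 : 0 < q by exact: lt_le_trans q1.
have s0 : 0 < Num.sqrt q by rewrite sqrtr_gt0.
have sq : Num.sqrt q ^+ 2 = q by rewrite sqr_sqrtr // ltW.
move: (Num.sqrt q) s0 sq lq => s s0 sq lq.
pose t := l / (2 * s).
have lE : l = 2 * s * t by rewrite /t; field; rewrite gt_eqF.
have t1 : `|t| <= 1.
  rewrite /t normrM normfV [`|2 * s|]ger0_norm; last by rewrite mulr_ge0 // ltW.
  by rewrite ler_pdivrMr ?mul1r // mulr_gt0.
pose w m := (1 - q^-1) * (chebyshev t m.+1).2 + 2 / q * (chebyshev t m).1.
have qn0 : q != 0 by rewrite gt_eqF.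
have sn0 : s != 0 by rewrite gt_eqF.
(* The closed form starts at index 1: [w 0 = 1 + 1/q] differs from 1, and this excess is what turns
   the coefficient [q] into [q + 1] in the recurrence for [p 2]. *)
have pE m : p m.+1 = s ^+ m.+1 * w m.+1 * p 0%N /\
            p m.+2 = s ^+ m.+2 * w m.+2 * p 0%N.
  elim: m => [|m [IH1 IH2]].
    by rewrite p2 p1 lE /w /= -sq; split; field; rewrite sn0.
  split=> //; rewrite p3 IH1 IH2 lE /w !chebyshev_rec /= -sq !exprS; field.
  by rewrite sn0.
have [-> _] := pE n.
rewrite !normrM ler_wpM2r // normrX (gtr0_norm s0) ler_pM2l ?exprn_gt0 //.
have c1 := chebyshev1_le1 t n.+1 t1.
have v1 := chebyshev2_le t n.+2 t1.
have iq1 : q^-1 <= 1 by rewrite invf_le1.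
have iq0 : 0 < q^-1 by rewrite invr_gt0.
rewrite /w (le_trans (ler_normD _ _)) // !normrM.
rewrite [`|1 - _|]ger0_norm ?subr_ge0 // [`|2|]ger0_norm //.
rewrite [`|q^-1|]gtr0_norm //.
move: v1; rewrite -[n.+2%:R]natr1 -[n.+1%:R]natr1.
have : 0 <= n%:R :> F by [].
move: (n%:R) (`|_.1|) (`|_.2|) (q^-1) c1 iq1 iq0 => N c v r c1 r1 r0 N0 vN.
(* With r = 1/q, the gap N + 2 - ((1 - r) v + 2 r c) equals (1 - r)(N + 2 - v) + 2 r (1 - c) + r N,
   a sum of nonnegative terms. *)
have : 0 <= (1 - r) * (N + 2 - v) by apply: mulr_ge0; lra.
have : 0 <= r * (1 - c) by apply: mulr_ge0; lra.
have : 0 <= r * N by apply: mulr_ge0; lra.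
rewrite !mulrBr !mulrBl !mulrDr; lra.
Qed.

(** * Counting non-backtracking walks *)

(* Counts the non-backtracking walks of length [n.+1] from [x] with last arc
   [(z, y)]. *)
Fixpoint nb_arc_count {V : finType} (e : rel V) (x : V) (n : nat) (z y : V) :
    nat :=
  if n is m.+1 then (e z y * \sum_(w | w != y) nb_arc_count e x m w z)%N
  else ((z == x) && e z y).

Definition nb_count {V : finType} (e : rel V) (x : V) (n : nat) (y : V) : nat :=
  if n is m.+1 then (\sum_z nb_arc_count e x m z y)%N else (y == x).

Lemma nb_arc_count_edge {V : finType} (e : rel V) (x : V) (n : nat) (z y : V) :
  ~~ e z y -> nb_arc_count e x n z y = 0%N.
Proof. by case: n => [|n] /= /negPf ->; rewrite ?andbF. Qed.

Lemma nb_arc_count_walk {V : finType} (e : rel V) (x : V) (n : nat) (z y : V) :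
  (0 < nb_arc_count e x n z y)%N ->
  exists f : nat -> V, [/\ f 0%N = x, f n = z, f n.+1 = y,
    forall i, (i <= n)%N -> e (f i) (f i.+1) &
    forall i, (i < n)%N -> f i.+2 != f i].
Proof.
elim: n z y => [|n IHn] z y /=.
  rewrite lt0b => /andP[/eqP -> exy].
  by exists (fun i => if i is 0%N then x else y); split=> // -[].
rewrite muln_gt0 lt0b => /andP[ezy].
rewrite lt0n sum_nat_eq0 negb_forall => /existsP[w].
rewrite negb_imply -lt0n => /andP[wy /IHn[f [f0 fn fn1 fe fb]]].
(* The walk [f] ends with the arc from [w] to [z] at indices [n] and [n.+1]; the new endpoint [y]
   takes index [n.+2], and [w != y] excludes backtracking there. *)
exists (fun i => if (i <= n.+1)%N then f i else y); split=> //.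
- by rewrite leqnn.
- by rewrite ltnn.
- move=> i iN; rewrite iN; case: ltnP => [|iN']; first exact: fe.
  have -> : i = n.+1 by apply/eqP; rewrite eqn_leq iN.
  by rewrite fn1.
- move=> i iN; rewrite (ltnW iN) ltnS.
  case: ltnP => [|iN']; first exact: fb.
  have -> : i = n by apply/eqP; rewrite eqn_leq -ltnS iN.
  by rewrite fn eq_sym.
Qed.

Lemma nb_count_missed {V : finType} (e : rel V) (x y : V) (n : nat) :
  y \in missed_vertices e x n -> nb_count e x n y = 0%N.
Proof.
rewrite inE => noW; apply/eqP; move: noW; apply: contraNT; rewrite -lt0n.
have build (f : nat -> V) : f 0%N = x -> f n = y ->
    (forall i, (i < n)%N -> e (f i) (f i.+1)) ->
    (forall i, (i.+1 < n)%N -> f i.+2 != f i) ->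
    [exists v : {ffun 'I_n.+1 -> V}, nonbacktracking_walk e x y v].
  move=> f0 fn fe fb; apply/existsP; exists [ffun i : 'I_n.+1 => f i].
  rewrite /nonbacktracking_walk !ffunE /= f0 fn !eqxx /=.
  apply/andP; split; apply/forallP => i; apply/forallP => j;
    apply/implyP => /eqP ji; rewrite !ffunE ji; [apply: fe | apply: fb];
    by rewrite -ltnS -ji.
case: n build => [|n] build /=.
  by rewrite lt0b => /eqP yx; apply: (build (fun=> x)).
rewrite lt0n sum_nat_eq0 negb_forall => /existsP[z].
rewrite /= -lt0n => /nb_arc_count_walk[f [f0 fn fn1 fe fb]].
exact: (build f).
Qed.

(** * Recurrences for the walk counts *)

Definition nb_row (F : realType) {V : finType} (e : rel V) (x : V) (n : nat) :
    'rV[F]_#|V| :=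
  \row_i (nb_count e x n (enum_val i))%:R.

Lemma mul_row_adjmx (F : realType) {V : finType} (e : rel V) (f : V -> nat) :
  (\row_i (f (enum_val i))%:R : 'rV[F]_#|V|) *m adjmx F e =
  \row_i (\sum_z f z * e z (enum_val i))%N%:R.
Proof.
apply/rowP => i; rewrite !mxE natr_sum.
rewrite [RHS](reindex_onto (@enum_val V predT) enum_rank) /=; last first.
  by move=> j _; rewrite enum_rankK.
apply: eq_big => [j|j _]; first by rewrite enum_valK eqxx.
by rewrite !mxE natrM.
Qed.

Lemma nb_row1 (F : realType) {V : finType} (e : rel V) (x : V) :
  nb_row F e x 1 = nb_row F e x 0 *m adjmx F e.
Proof.
rewrite mul_row_adjmx; apply/rowP => i; rewrite !mxE; congr _%:R.
by apply: eq_bigr => z _; rewrite mulnb.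
Qed.

(** An edge from [z] to [y] appended to a walk ending at [z] either keeps it non-backtracking or
    reverses its last arc, which was then the arc from [y] to [z]. *)
Lemma nb_count_SS {V : finType} (e : rel V) (x : V) (n : nat) (y : V) :
  symmetric e ->
  (nb_count e x n.+2 y + \sum_z nb_arc_count e x n y z =
   \sum_z nb_count e x n.+1 z * e z y)%N.
Proof.
move=> symG.
rewrite /= -big_split /=; apply: eq_bigr => z _.
rewrite [RHS]mulnC [in RHS](bigD1 y) //= mulnDr [RHS]addnC; congr addn.
case: (boolP (e z y)) => [|zy]; first by rewrite mul1n.
by rewrite nb_arc_count_edge // symG.
Qed.

Lemma sum_nb_arc0 {V : finType} (e : rel V) (x : V) (k : nat) (y : V) :
  regular_graph e k ->
  (\sum_z nb_arc_count e x 0 y z = k * nb_count e x 0 y)%N.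
Proof.
move=> regG.
rewrite /= -(regG y) -sum1_card big_distrl /= [RHS]big_mkcond /=.
apply: eq_bigr => z _; rewrite inE mul1n.
by case: (y == x) => //; case: (e y z).
Qed.

(** A walk that reached [y] from [w] continues to every neighbour of [y] except [w], giving [k.-1]
    choices; a walk of length 0 has all [k], hence the separate first step. *)
Lemma sum_nb_arcS {V : finType} (e : rel V) (x : V) (k n : nat) (y : V) :
  symmetric e -> regular_graph e k ->
  (\sum_z nb_arc_count e x n.+1 y z = k.-1 * nb_count e x n.+1 y)%N.
Proof.
move=> symG regG.
rewrite /= big_distrr /=.
under eq_bigr => z _ do rewrite big_distrr /= big_mkcond /=.
rewrite exchange_big /=; apply: eq_bigr => w _.
case: (boolP (e w y)) => [wy|wy]; last first.
  by rewrite nb_arc_count_edge // muln0 big1 // => z _; rewrite muln0 if_same.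
rewrite -(regG y) (cardsD1 w) inE symG wy /= -sum1_card big_distrl /=.
rewrite [RHS]big_mkcond /=; apply: eq_bigr => z _.
rewrite !inE mul1n [z == w]eq_sym; case: (w == z) => //=.
by case: (e y z); rewrite ?mul1n.
Qed.

Lemma nb_row2 (F : realType) {V : finType} (e : rel V) (x : V) (k : nat) :
  symmetric e -> regular_graph e k ->
  nb_row F e x 2 = nb_row F e x 1 *m adjmx F e - k%:R *: nb_row F e x 0.
Proof.
move=> symG regG.
rewrite mul_row_adjmx; apply/rowP => i; rewrite !mxE -natrM.
by rewrite -nb_count_SS // (sum_nb_arc0 e x k) // natrD addrK.
Qed.

Lemma nb_rowSSS (F : realType) {V : finType} (e : rel V) (x : V) (k n : nat) :
  symmetric e -> regular_graph e k ->
  nb_row F e x n.+3 =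
  nb_row F e x n.+2 *m adjmx F e - k.-1%:R *: nb_row F e x n.+1.
Proof.
move=> symG regG.
rewrite mul_row_adjmx; apply/rowP => i; rewrite !mxE -natrM.
by rewrite -nb_count_SS // (sum_nb_arcS e x k) // natrD addrK.
Qed.

(** * Deviation of the walk counts from their mean *)

(** The total number of non-backtracking walks of length [n] from a vertex. It enters the proof
    through the recurrences that it shares with [nb_row]. *)
Definition nb_degree (F : pzRingType) (k n : nat) : F :=
  if n is m.+1 then k%:R * k.-1%:R ^+ m else 1.

Definition nb_deviation (F : realType) {V : finType} (e : rel V) (x : V)
    (k n : nat) : 'rV[F]_#|V| :=
  nb_row F e x n - (nb_degree F k n / #|V|%:R) *: const_mx 1.

Lemma const_mx_adjmx (F : realType) {V : finType} (e : rel V) (k : nat) :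
  symmetric e -> regular_graph e k ->
  (const_mx 1 : 'rV[F]_#|V|) *m adjmx F e = k%:R *: const_mx 1.
Proof.
move=> symG regG; apply/rowP => j; rewrite !mxE mulr1.
rewrite -(sum_adjmx F j symG regG); apply: eq_bigr => i _.
by rewrite !mxE mul1r.
Qed.

Lemma nb_deviation1 (F : realType) {V : finType} (e : rel V) (x : V) (k : nat) :
  symmetric e -> regular_graph e k ->
  nb_deviation F e x k 1 = nb_deviation F e x k 0 *m adjmx F e.
Proof.
move=> symG regG.
rewrite /nb_deviation mulmxBl -scalemxAl (const_mx_adjmx F e k) // -nb_row1.
by rewrite scalerA /= expr0 mulr1 mul1r [_^-1 * _]mulrC.
Qed.

(** The constant part obeys the same recurrence as the counts, because k k - k = k (k - 1). *)
Lemma nb_deviation2 (F : realType) {V : finType} (e : rel V) (x : V) (k : nat) :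
  (0 < k)%N -> symmetric e -> regular_graph e k ->
  nb_deviation F e x k 2 =
  nb_deviation F e x k 1 *m adjmx F e - k%:R *: nb_deviation F e x k 0.
Proof.
move=> k0 symG regG.
rewrite /nb_deviation mulmxBl -scalemxAl (const_mx_adjmx F e k) //.
rewrite (nb_row2 F e x k) //= -[in k%:R](prednK k0) -natr1.
by apply/rowP => i; rewrite !mxE; ring.
Qed.

Lemma nb_deviationSSS (F : realType) {V : finType} (e : rel V) (x : V)
    (k n : nat) :
  (0 < k)%N -> symmetric e -> regular_graph e k ->
  nb_deviation F e x k n.+3 =
  nb_deviation F e x k n.+2 *m adjmx F e -
  k.-1%:R *: nb_deviation F e x k n.+1.
Proof.
move=> k0 symG regG.
rewrite /nb_deviation mulmxBl -scalemxAl (const_mx_adjmx F e k) //.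
rewrite (nb_rowSSS F e x k) //= -[in k%:R](prednK k0) -natr1 !exprS.
by apply/rowP => i; rewrite !mxE; ring.
Qed.

Lemma sum_nb_row0 (F : realType) {V : finType} (e : rel V) (x : V) :
  \sum_i nb_row F e x 0 0 i = 1.
Proof.
rewrite (bigD1 (enum_rank x)) //= big1 => [|i ix].
  by rewrite mxE enum_rankK /= eqxx addr0.
rewrite mxE /=; case: eqP => // ixE; case/eqP: ix.
by rewrite -ixE enum_valK.
Qed.

(** The exact value is [1 - c] with [c = 1 / #|V|]: an indicator d satisfies d^2 = d, so (d - c)^2
    is linear in d. *)
Lemma nb_deviation0_norm (F : realType) {V : finType} (e : rel V) (x : V)
    (k : nat) :
  \sum_i nb_deviation F e x k 0 0 i ^+ 2 <= 1.
Proof.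
have n0 : 0 < #|V|%:R :> F by rewrite ltr0n; apply/card_gt0P; exists x.
set c := #|V|%:R^-1 : F.
have -> : \sum_i nb_deviation F e x k 0 0 i ^+ 2 =
    \sum_i ((1 - 2 * c) * nb_row F e x 0 0 i + c ^+ 2).
  apply: eq_bigr => i _; rewrite !mxE /= -/c.
  by case: (_ == x); rewrite /=; ring.
rewrite big_split /= -mulr_sumr sum_nb_row0 sumr_const card_ord.
rewrite -[c ^+ 2 *+ _]mulr_natr.
have -> : c ^+ 2 * #|V|%:R = c by rewrite /c; field; rewrite gt_eqF.
have : 0 < c by rewrite invr_gt0.
by lra.
Qed.

(** The trivial eigenspace has rank 1, so [v] is constant, while the entries of the deviation sum to
    0. *)
Lemma nb_deviation0_ortho (F : realType) {V : finType} (e : rel V) (x : V)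
    (k : nat) (v : 'cV[F]_#|V|) :
  simple_graph e -> graph_connected e -> regular_graph e k ->
  adjmx F e *m v = k%:R *: v ->
  (nb_deviation F e x k 0 *m v) 0 0 = 0.
Proof.
move=> simG connG regG Av; have [symG _] := simG.
have n0 : 0 < #|V|%:R :> F by rewrite ltr0n; apply/card_gt0P; exists x.
pose u : 'rV[F]_#|V| := const_mx 1.
have uE : (u <= eigenspace (adjmx F e) k%:R)%MS.
  by apply/eigenspaceP; exact: const_mx_adjmx.
have u0 : u != 0.
  apply/eqP => /matrixP /(_ ord0 (enum_rank x)); rewrite !mxE => /eqP.
  by rewrite oner_eq0.
have symA : (adjmx F e)^T = adjmx F e.
  by apply/matrixP => i j; rewrite !mxE symG.
have /sub_rVP[c vE] : (v^T <= u)%MS.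
  apply: (@submx_trans _ _ _ _ _ _ (eigenspace (adjmx F e) k%:R)).
    by apply/eigenspaceP; rewrite -symA -trmx_mul Av linearZ.
  rewrite -(mxrank_leqif_sup uE) rank_rV u0.
  by rewrite (rank_trivial_eigenspace F _ _ regG).
have vc i : v i 0 = c by move/matrixP: vE => /(_ 0 i); rewrite !mxE mulr1.
rewrite mxE; under eq_bigr => i _ do rewrite vc.
rewrite -mulr_suml.
under eq_bigr => i _ do rewrite mxE.
rewrite big_split /= sum_nb_row0.
under eq_bigr => i _ do rewrite !mxE /= mulr1 mul1r.
rewrite sumr_const card_ord -[(- _) *+ _]mulr_natr mulNr.
by rewrite mulVf ?gt_eqF // subrr mul0r.
Qed.

Lemma nb_deviation_norm (F : realType) {V : finType} (e : rel V) (x : V)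
    (k r : nat) :
  (1 < k)%N -> ramanujan_graph F e k ->
  \sum_i nb_deviation F e x k r.+1 0 i ^+ 2 <= k.-1%:R ^+ r.+1 * r.+2%:R ^+ 2.
Proof.
move=> k1 [simG connG regG ram]; have [symG _] := simG.
have k0 : (0 < k)%N by exact: ltnW.
set q : F := k.-1%:R.
have kE : k%:R = q + 1 :> F by rewrite natr1 prednK.
have q1 : 1 <= q by rewrite ler1n -ltnS prednK.
have q0 : 0 <= q by exact: le_trans q1.
pose B := Num.sqrt q ^+ r.+1 * r.+2%:R.
have -> : q ^+ r.+1 * r.+2%:R ^+ 2 = B ^+ 2 * 1.
  by rewrite mulr1 exprMn -exprM mulnC exprM sqr_sqrtr.
have symA : (adjmx F e)^T = adjmx F e.
  by apply/matrixP => i j; rewrite !mxE symG.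
apply: le_trans (_ : B ^+ 2 * \sum_i nb_deviation F e x k 0 0 i ^+ 2 <= _).
  apply: (symmetric_norm_bound _ _ _ _ _ _ symA) => l v Av.
  (* Pairing with an eigenvector turns the matrix recurrences into scalar ones with [l] in place of
     the matrix. *)
  pose p n := (nb_deviation F e x k n *m v) 0 0.
  have p1 : p 1%N = l * p 0%N.
    by rewrite /p nb_deviation1 // -mulmxA Av -scalemxAr mxE.
  have p2 : p 2 = l * p 1%N - (q + 1) * p 0%N.
    rewrite /p nb_deviation2 // mulmxBl -mulmxA Av.
    by rewrite -scalemxAr -scalemxAl !mxE kE.
  have p3 n : p n.+3 = l * p n.+2 - q * p n.+1.
    rewrite /p nb_deviationSSS // mulmxBl -mulmxA Av.
    by rewrite -scalemxAr -scalemxAl !mxE.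
  have [v0|v0] := eqVneq v 0; first by rewrite v0 !mulmx0 !mxE normr0 mulr0.
  have [lk|lk] := eqVneq l k%:R.
    have p00 : p 0%N = 0 by apply: nb_deviation0_ortho => //; rewrite Av lk.
    have p0n n : p n.+1 = 0 /\ p n.+2 = 0.
      elim: n => [|n [h1 h2]]; first by rewrite p2 p1 p00 !mulr0 subr0.
      by split=> //; rewrite p3 h1 h2 !mulr0 subr0.
    by rewrite -/(p r.+1) -/(p 0%N) p00 (p0n r).1 !normr0 mulr0.
  have lq : `|l| <= 2 * Num.sqrt q; last first.
    exact: (nonbacktracking_recurrence_bound F q l p q1 lq p1 p2 p3 r).
  have -> : q = k%:R - 1 by rewrite kE addrK.
  apply: ram lk; apply/eigenvalueP; exists v^T.
    by rewrite -symA -trmx_mul Av linearZ.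
  by rewrite trmx_eq0.
by rewrite ler_wpM2l ?sqr_ge0 // nb_deviation0_norm.
Qed.

(** * Counting the missed vertices *)

Lemma card_missed_vertices_le (F : realType) {V : finType} (e : rel V) (x : V)
    (k r : nat) :
  (1 < k)%N -> ramanujan_graph F e k ->
  #|missed_vertices e x r.+1|%:R * (k.-1%:R : F) ^+ r.+1 <=
  #|V|%:R ^+ 2 * r.+2%:R ^+ 2.
Proof.
move=> k1 ramG.
have n0 : 0 < #|V|%:R :> F by rewrite ltr0n; apply/card_gt0P; exists x.
have := nb_deviation_norm F e x k r k1 ramG.
set q : F := k.-1%:R; set M := missed_vertices e x r.+1.
have q0 : 0 < q by rewrite ltr0n -ltnS prednK // ltnW.
have qk : q <= k%:R by rewrite ler_nat leq_pred.
set c := nb_degree F k r.+1 / #|V|%:R => normB.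
have : #|M|%:R * c ^+ 2 <= q ^+ r.+1 * r.+2%:R ^+ 2.
  apply: le_trans normB.
  have -> : #|M|%:R * c ^+ 2 = \sum_(i < #|V| | enum_val i \in M) c ^+ 2.
    rewrite sumr_const mulr_natl; congr (_ *+ _).
    rewrite -(card_imset _ enum_val_inj); apply: eq_card => y.
    apply/idP/imsetP => [yM|[i iM ->]//].
    by exists (enum_rank y); rewrite ?unfold_in /= enum_rankK.
  rewrite big_mkcond; apply: ler_sum => i _.
  case: ifP => [iM|_]; last exact: sqr_ge0.
  by rewrite !mxE nb_count_missed // mulr1 sub0r sqrrN.
(* Lowering the factor [k] to [q] leaves a pure power of [q], of which one factor [q ^+ r.+1] then
   cancels. *)
have cE : q ^+ r.+1 / #|V|%:R <= c.
  by rewrite /c ler_pM2r ?invr_gt0 // exprS ler_wpM2r ?exprn_ge0 // ltW.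
move=> h.
have {}h : #|M|%:R * (q ^+ r.+1 / #|V|%:R) ^+ 2 <= q ^+ r.+1 * r.+2%:R ^+ 2.
  apply: le_trans h; rewrite ler_wpM2l // ler_sqr ?nnegrE //.
    by rewrite divr_ge0 ?exprn_ge0 // ltW.
  by apply: le_trans cE; rewrite divr_ge0 ?exprn_ge0 // ltW.
have Q0 : 0 < q ^+ r.+1 by rewrite exprn_gt0.
rewrite -(ler_pM2l Q0).
move: h; rewrite expr_div_n mulrA ler_pdivrMr ?exprn_gt0 //.
by congr (_ <= _); ring.
Qed.

Theorem theorem1p2 (F : realType) (V : finType) (e : rel V) (k : nat)
    (k_ge3 : (3 <= k)%N) (ramG : ramanujan_graph F e k)
    (eps : F) (eps_gt0 : 0 < eps) (x : V) (R : nat)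
    (R_large : (1 + eps) * logb (k%:R - 1) #|V|%:R < R%:R) :
  #|missed_vertices e x R|%:R <= #|V|%:R `^ (1 - eps) * (1 + R%:R) ^+ 2.
Proof.
have k1 : (1 < k)%N by exact: ltnW.
have n1 : 1 <= #|V|%:R :> F by rewrite ler1n; apply/card_gt0P; exists x.
have n0 : 0 < #|V|%:R :> F by exact: lt_le_trans n1.
have qE : k%:R - 1 = k.-1%:R :> F.
  by rewrite -[in LHS](prednK (ltnW k1)) -natr1 addrK.
have q1 : 1 < k.-1%:R :> F by rewrite ltr1n -ltnS prednK // ltnW.
have q0 : 0 < k.-1%:R :> F by exact: lt_trans q1.
have lnq : 0 < ln (k.-1%:R : F) by rewrite ln_gt0.
move: R_large; rewrite /logb qE mulrA ltr_pdivrMr // => R_large.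
(* The bounds concern positive lengths; [R = 0] contradicts [R_large], since [ln #|V|] is
   nonnegative. *)
case: R R_large => [|r] R_large.
  move: R_large; rewrite mul0r ltNge mulr_ge0 ?ln_ge0 //.
  by rewrite addr_ge0 // ltW.
(* This is [R_large] exponentiated. Multiplying the goal by this power of [#|V|] makes its exponents
   add up to 2, matching the previous lemma. *)
have nq : #|V|%:R `^ (1 + eps) <= k.-1%:R ^+ r.+1 :> F.
  rewrite -ler_ln ?posrE ?powR_gt0 ?exprn_gt0 // ln_powR lnXn //.
  by rewrite -[ln _ *+ _]mulr_natl ltW.
have N0 : 0 < #|V|%:R `^ (1 + eps) by rewrite powR_gt0.
rewrite -(ler_pM2r N0) nat1r.
apply: le_trans (ler_wpM2l _ nq) _; first exact: ler0n.
apply: le_trans (card_missed_vertices_le F e x k r k1 ramG) _.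
rewrite [leRHS]mulrAC -powRD; last by rewrite (gt_eqF n0) implybT.
have -> : 1 - eps + (1 + eps) = 2%:R by ring.
by rewrite powR_mulrn // ltW.
Qed.
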